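(* Let $\mathcal{A}$ be a unital stably finite algebra over $\mathbb{C}$. Let $f\in\mathcal{M}_d$ have formal representations $(A,b,c;\vec h)$ and $(A',b',c';\vec h')$, and suppose that $a=(a_1,\dots,a_d)\in\mathcal{A}^{1\times d}$ belongs to $\mathcal{D}_{\mathcal{A}}(A;\vec h)\cap\mathcal{D}_{\mathcal{A}}(A';\vec h')$. Then $$(1_{\mathcal{A}}\otimes b^* )\,A(\vec h(a))^{-1}\,(1_{\mathcal{A}}\otimes c)=(1_{\mathcal{A}}\otimes b'^{*})\,A'(\vec h'(a))^{-1}\,(1_{\mathcal{A}}\otimes c').$$ That is, $f$ is well defined on $\mathrm{Dom}_{\mathcal{A}}(f)\subseteq\mathcal{A}^{1\times d}$.
   Context: $\mathcal{O}_d$ is the ring of uniformly entire NC functions: formal power series $h=\sum_{\omega}\hat h_\omega z^\omega$ over words $\omega$ in $\{1,\dots,d\}$, in non-commuting variables $z=(z_1,\dots,z_d)$, with $\lim_{\ell\to\infty}\big(\sum_{|\omega|=\ell}|\hat h_\omega|^2\big)^{1/(2\ell)}=0$. It is a semifir (every finitely generated right ideal is free), so by Cohn it has a universal skew field of fractions $\mathcal{M}_d$: a skew field containing, and generated by, $\mathcal{O}_d$, over which every full square matrix over $\mathcal{O}_d$ becomes invertible. Here the inner rank of $M\in\mathcal{O}_d^{m\times n}$ is the least $k$ with $M=BC$, $B\in\mathcal{O}_d^{m\times k}$, $C\in\mathcal{O}_d^{k\times n}$, and a square $n\times n$ matrix is full if its inner rank is $n$. The embedding $\mathcal{O}_d\hookrightarrow\mathcal{M}_d$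 preserves inner rank. A formal representation $(A,b,c;\vec h)$ of $f\in\mathcal{M}_d$ consists of $n,k\in\mathbb{N}$, $A=(A_0,\dots,A_k)$ with $A_j\in\mathbb{C}^{n\times n}$, $b,c\in\mathbb{C}^n$ and $\vec h=(h_1,\dots,h_k)\in\mathcal{O}_d^{1\times k}$ such that $A(\vec h):=A_0+\sum_{j=1}^kh_jA_j\in\mathcal{O}_d^{n\times n}$ is invertible over $\mathcal{M}_d$ and $f=b^*A(\vec h)^{-1}c$ in $\mathcal{M}_d$. Every $f\in\mathcal{M}_d$ has such a representation; different representations may have different $n,k$. A unital algebra $\mathcal{A}$ is stably finite if for all $n$ and $X,Y\in\mathcal{A}^{n\times n}$, $XY=I$ implies $YX=I$. Given $a\in\mathcal{A}^{1\times d}$, let $\varphi_a:\mathcal{O}_d\to\mathcal{A}$ denote a unital homomorphism with $\varphi_a(z_i)=a_i$, $1\le i\le d$ (if one exists; a single such $\varphi_a$ is used throughout), write $h(a):=\varphi_a(h)$, and $A(\vec h(a)):=1_{\mathcal{A}}\otimes A_0+\sum_jh_j(a)\otimes A_j\in\mathcal{A}\otimes\mathbb{C}^{n\times n}=\mathcal{A}^{n\times n}$. Then $a\in\mathcal{D}_{\mathcal{A}}(A;\vec h)$ means that such a $\varphi_a$ exists and $A(\vec h(a))$ is invertible in $\mathcal{A}^{n\times n}$. $\mathrm{Dom}_{\mathcal{A}}(f)$ is the set of $a$ belonging to $\mathcal{D}_{\mathcal{A}}(A;\vec h)$ for some formal representation $(A,b,c;\vec h)$ of $f$, and for such $a$ one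 defines $f(a):=(1_{\mathcal{A}}\otimes b^* )A(\vec h(a))^{-1}(1_{\mathcal{A}}\otimes c)$. *)

(* Defs.v *)
From HB Require Import structures.
From mathcomp Require Import all_boot all_order all_algebra.
From mathcomp Require Import complex.
From mathcomp Require Import all_classical all_reals all_analysis.
From mathcomp Require Import ring lra.

Set Implicit Arguments.
Unset Strict Implicit.
Unset Printing Implicit Defensive.

Import Order.TTheory GRing.Theory Num.Theory.
Import numFieldNormedType.Exports.
Import ComplexField.
Local Open Scope classical_set_scope.
Local Open Scope ring_scope.
Local Open Scope complex_scope.

(* A formal power series in d non-commuting variables is the family of its
   coefficients, indexed by words; words multiply by concatenation. *)
Definition ncseries (R : realType) (d : nat) : Type := seq 'I_d -> R[i].

Section NCSeries.
Variables (R : realType) (d : nat).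
Local Notation S := (ncseries R d).
Implicit Types (f g h : S) (w : seq 'I_d) (x : 'I_d).

HB.instance Definition _ := GRing.Lmodule.copy S (seq 'I_d -> R[i]^o).

Definition ncone : S := fun w => (w == [::])%:R.

Definition ncmul f g : S :=
  fun w => \sum_(i < (size w).+1) f (take i w) * g (drop i w).

Definition ncvar x : S := fun w => (w == [:: x])%:R.

Definition ncshift x f : S := fun w => f (x :: w).

Lemma ncaddE f g w : (f + g) w = f w + g w. Proof. by []. Qed.
Lemma ncscaleE (a : R[i]) f w : (a *: f) w = a * f w. Proof. by []. Qed.

Lemma ncmul_nil f g : ncmul f g [::] = f [::] * g [::].
Proof. by rewrite /ncmul big_ord1. Qed.

Lemma ncmul_cons f g x w :
  ncmul f g (x :: w) = f [::] * g (x :: w) + ncmul (ncshift x f) g w.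
Proof. by rewrite /ncmul /= big_ord_recl /=. Qed.

Lemma ncshift_mul f g x :
  ncshift x (ncmul f g) = f [::] *: ncshift x g + ncmul (ncshift x f) g.
Proof.
by apply/funext => w; rewrite ncaddE ncscaleE /ncshift ncmul_cons.
Qed.

Fact ncmulDl : left_distributive ncmul +%R.
Proof.
move=> f g h; apply/funext => w; rewrite ncaddE /ncmul -big_split /=.
by apply: eq_bigr => i _; rewrite ncaddE mulrDl.
Qed.

Fact ncmulDr : right_distributive ncmul +%R.
Proof.
move=> f g h; apply/funext => w; rewrite ncaddE /ncmul -big_split /=.
by apply: eq_bigr => i _; rewrite ncaddE mulrDr.
Qed.

Fact ncscaleAl (a : R[i]) f g : a *: ncmul f g = ncmul (a *: f) g.
Proof.
apply/funext => w; rewrite ncscaleE /ncmul mulr_sumr.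
by apply: eq_bigr => i _; rewrite ncscaleE mulrA.
Qed.

Fact ncscaleAr (a : R[i]) f g : a *: ncmul f g = ncmul f (a *: g).
Proof.
apply/funext => w; rewrite ncscaleE /ncmul mulr_sumr.
by apply: eq_bigr => i _; rewrite ncscaleE mulrCA.
Qed.

Fact ncmulA : associative ncmul.
Proof.
move=> f g h; apply/funext => w; elim: w f g h => [|x w IHw] f g h.
  by rewrite !ncmul_nil mulrA.
rewrite !ncmul_cons ncshift_mul ncmulDl ncaddE -ncscaleAl ncscaleE ncmul_nil.
by rewrite IHw mulrDr mulrA addrA.
Qed.

Fact ncmul1s : left_id ncone ncmul.
Proof.
move=> f; apply/funext => -[|x w].
  by rewrite ncmul_nil /ncone eqxx mul1r.
rewrite ncmul_cons {1}/ncone eqxx mul1r /ncmul big1 ?addr0 // => i _.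
by rewrite /ncshift /ncone /= mul0r.
Qed.

Fact ncmuls1 : right_id ncone ncmul.
Proof.
move=> f; apply/funext => w; elim: w f => [|x w IHw] f.
  by rewrite ncmul_nil /ncone eqxx mulr1.
by rewrite ncmul_cons /ncone /= mulr0 add0r IHw.
Qed.

Fact ncone_neq0 : ncone != 0 :> S.
Proof.
apply/eqP => /(congr1 (fun f : S => f [::])).
by rewrite /ncone eqxx => /eqP; rewrite oner_eq0.
Qed.

HB.instance Definition _ := GRing.Zmodule_isNzRing.Build S
  ncmulA ncmul1s ncmuls1 ncmulDl ncmulDr ncone_neq0.
HB.instance Definition _ := GRing.Lmodule_isLalgebra.Build R[i] S ncscaleAl.
HB.instance Definition _ := GRing.Lalgebra_isAlgebra.Build R[i] S ncscaleAr.

Lemma ncmulE f g : f * g = ncmul f g. Proof. by []. Qed.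

Definition level_sqnorm h (l : nat) : R :=
  \sum_(w : l.-tuple 'I_d) Normc.normc (h w) ^+ 2.

(* For l = 0 the exponent is 1 / 0 = 0, which does not affect the limit. *)
Definition uniformly_entire : {pred S} := fun h =>
  `[< (fun l => level_sqnorm h l `^ ((2 * l)%:R^-1)) @ \oo --> (0 : R) >].

Lemma level_sqnorm_ge0 h l : 0 <= level_sqnorm h l.
Proof. by apply: sumr_ge0 => w _; rewrite sqr_ge0. Qed.

Lemma level_sqnorm0 h : level_sqnorm h 0 = Normc.normc (h [::]) ^+ 2.
Proof.
rewrite /level_sqnorm (big_pred1 [tuple]) //= => t.
by apply/esym/eqP; exact: tuple0.
Qed.

Lemma level_sqnormS h l :
  level_sqnorm h l.+1 = \sum_(x < d) level_sqnorm (ncshift x h) l.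
Proof.
rewrite /level_sqnorm pair_big /=.
rewrite (reindex (fun p : 'I_d * l.-tuple 'I_d => [tuple of p.1 :: p.2])) //=.
exists (fun t : l.+1.-tuple 'I_d => (thead t, [tuple of behead t])) => [[x t]|t] _.
  by congr pair; apply: val_inj.
by rewrite -tuple_eta.
Qed.

Lemma normcD_sqr (a b : R[i]) :
  Normc.normc (a + b) ^+ 2 <= 2 * (Normc.normc a ^+ 2 + Normc.normc b ^+ 2).
Proof.
move: a b => [a1 a2] [b1 b2] /=.
rewrite !sqr_sqrtr ?addr_ge0 ?sqr_ge0//.
have := sqr_ge0 (a1 - b1); have := sqr_ge0 (a2 - b2); nra.
Qed.

Lemma level_sqnormD f g l :
  level_sqnorm (f + g) l <= 2 * (level_sqnorm f l + level_sqnorm g l).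
Proof.
rewrite /level_sqnorm -big_split mulr_sumr /=.
by apply: ler_sum => w _; exact: normcD_sqr.
Qed.

Lemma level_sqnormZ (a : R[i]) f l :
  level_sqnorm (a *: f) l = Normc.normc a ^+ 2 * level_sqnorm f l.
Proof.
rewrite /level_sqnorm mulr_sumr; apply: eq_bigr => w _.
by rewrite ncscaleE Normc.normcM exprMn.
Qed.

Lemma level_sqnormM f g l :
  level_sqnorm (f * g) l <=
  2 ^+ l * \sum_(i < l.+1) level_sqnorm f i * level_sqnorm g (l - i).
Proof.
elim: l f => [|l IHl] f.
  rewrite big_ord1 subn0 expr0 mul1r !level_sqnorm0 ncmulE ncmul_nil.
  by rewrite Normc.normcM exprMn.
rewrite big_ord_recl subn0 level_sqnormS.
have step x : level_sqnorm (ncshift x (f * g)) l <=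
    2 * (level_sqnorm f 0 * level_sqnorm (ncshift x g) l) +
    2 * (2 ^+ l * \sum_(i < l.+1)
           level_sqnorm (ncshift x f) i * level_sqnorm g (l - i)).
  rewrite ncmulE ncshift_mul (le_trans (level_sqnormD _ _ _))// mulrDr.
  by rewrite level_sqnormZ level_sqnorm0 lerD2l ler_pM2l// IHl.
apply: (le_trans (ler_sum _ (fun x _ => step x))).
rewrite big_split /= -!mulr_sumr -level_sqnormS exchange_big /=.
under [X in 2 * (2 ^+ l * X)]eq_bigr => i _ do
  rewrite -mulr_suml -level_sqnormS.
rewrite [X in _ + X <= _]mulrA -exprS mulrDr.
under [X in _ <= _ + _ * X]eq_bigr => i _ do rewrite /bump add1n subSS.
rewrite lerD2r ler_wpM2r ?mulr_ge0 ?level_sqnorm_ge0//.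
by rewrite exprS ler_peMr// exprn_ege1// ler1n.
Qed.

Definition subgeometric h := forall e : R, 0 < e ->
  exists C : R, forall l, level_sqnorm h l <= C * e ^+ l.

Lemma subgeometricM f g : subgeometric f -> subgeometric g ->
  subgeometric (f * g).
Proof.
move=> Hf Hg e e0; have d0 : 0 < e / 4 by rewrite divr_gt0.
have [C HC] := Hf _ d0; have [D HD] := Hg _ d0.
have C0 : 0 <= C.
  by have := HC 0; rewrite expr0 mulr1; apply: le_trans; exact: level_sqnorm_ge0.
have D0 : 0 <= D.
  by have := HD 0; rewrite expr0 mulr1; apply: le_trans; exact: level_sqnorm_ge0.
exists (C * D) => l; apply: le_trans (level_sqnormM f g l) _.
have -> : C * D * e ^+ l = 2 ^+ l * (2 ^+ l * (C * D * (e / 4) ^+ l)).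
  have -> : e ^+ l = 2 ^+ l * 2 ^+ l * (e / 4) ^+ l by rewrite -!exprMn; congr (_ ^+ _); field.
  by ring.
rewrite ler_pM2l ?exprn_gt0//.
apply: (@le_trans _ _ (\sum_(i < l.+1) C * D * (e / 4) ^+ l)).
  apply: ler_sum => -[i /= il] _.
  rewrite -(subnKC (ltnSE il)) exprD addKn [leRHS](_ : _ = (C * (e / 4) ^+ i) * (D * (e / 4) ^+ (l - i))); last by ring.
  by rewrite ler_pM ?level_sqnorm_ge0.
rewrite sumr_const card_ord -[leLHS]mulr_natl ler_wpM2r//.
  by rewrite !mulr_ge0// exprn_ge0// ltW.
by rewrite -natrX ler_nat ltn_expl.
Qed.

Lemma subgeometricD f g : subgeometric f -> subgeometric g ->
  subgeometric (f + g).
Proof.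
move=> Hf Hg e e0; have [C HC] := Hf _ e0; have [D HD] := Hg _ e0.
exists (2 * (C + D)) => l; apply: le_trans (level_sqnormD _ _ _) _.
by rewrite -mulrA ler_pM2l// mulrDl lerD.
Qed.

Lemma subgeometricZ (a : R[i]) f : subgeometric f -> subgeometric (a *: f).
Proof.
move=> Hf e e0; have [C HC] := Hf _ e0.
exists (Normc.normc a ^+ 2 * C) => l; rewrite level_sqnormZ -[leRHS]mulrA.
by rewrite ler_wpM2l ?sqr_ge0.
Qed.

Lemma finsupp_subgeometric h (N : nat) :
  (forall w, (N < size w)%N -> h w = 0) -> subgeometric h.
Proof.
move=> hN e e0; exists (\sum_(i < N.+1) level_sqnorm h i / e ^+ i) => l.
have e_gt0 i : 0 < e ^+ i by rewrite exprn_gt0.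
have [lN|Nl] := leqP l N.
  rewrite -ler_pdivrMr// (bigD1 (Ordinal (lN : (l < N.+1)%N)))//= lerDl.
  by apply: sumr_ge0 => i _; rewrite divr_ge0 ?level_sqnorm_ge0// ltW.
rewrite /level_sqnorm [leLHS]big1.
  apply: mulr_ge0; last exact: ltW.
  apply: sumr_ge0 => i _.
  by rewrite divr_ge0 ?level_sqnorm_ge0// ltW.
by move=> w _; rewrite hN ?size_tuple// Normc.normc0 expr0n.
Qed.

Lemma root_powK (x : R) (l : nat) : (0 < l)%N -> 0 <= x ->
  (x `^ ((2 * l)%:R^-1)) ^+ (2 * l) = x.
Proof.
move=> l0 x0; rewrite -powR_mulrn ?powR_ge0// -powRrM mulVf ?powRr1//.
by rewrite pnatr_eq0 -lt0n muln_gt0.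
Qed.

Lemma uniformly_entireP h : reflect (subgeometric h) (h \in uniformly_entire).
Proof.
apply: (iffP (asboolP _)).
  move=> /cvgrPdist_lt Hh e e0; have s0 : 0 < Num.sqrt e by rewrite sqrtr_gt0.
  have [N _ HN] := Hh _ s0.
  have e_gt0 i : 0 < e ^+ i by rewrite exprn_gt0.
  pose s := \sum_(i < N.+1) level_sqnorm h i / e ^+ i.
  have s_ge0 : 0 <= s.
    by apply: sumr_ge0 => i _; rewrite divr_ge0 ?level_sqnorm_ge0// ltW.
  exists (1 + s) => l; have [lN|Nl] := leqP l N.
    rewrite -ler_pdivrMr// /s (bigD1 (Ordinal (lN : (l < N.+1)%N)))//=.
    rewrite addrCA lerDl addr_ge0// sumr_ge0// => i _.
    by rewrite divr_ge0 ?level_sqnorm_ge0// ltW.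
  have := HN l (ltnW Nl); rewrite /= sub0r normrN ger0_norm ?powR_ge0// => Hl.
  have l0 : (0 < l)%N by apply: leq_ltn_trans Nl.
  rewrite -[level_sqnorm h l](root_powK l0) ?level_sqnorm_ge0//.
  apply: (@le_trans _ _ (e ^+ l)); last by rewrite ler_peMl ?lerDl// ltW.
  have -> : e ^+ l = Num.sqrt e ^+ (2 * l) by rewrite exprM sqr_sqrtr ?ltW.
  by rewrite lerXn2r ?nnegrE ?powR_ge0// ltW.
move=> Hh; apply/cvgrPdist_lt => e e0.
have d0 : 0 < (e / 2) ^+ 2 / 2 by rewrite !(divr_gt0, exprn_gt0).
have [C HC] := Hh _ d0.
exists (Num.Def.truncn `|C|).+1 => //= l Nl.
have l0 : (0 < l)%N by apply: leq_trans Nl.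
rewrite sub0r normrN ger0_norm ?powR_ge0//.
apply: (@le_lt_trans _ _ (e / 2)); last by lra.
rewrite -(@ler_pXn2r _ (2 * l)) ?muln_gt0// ?nnegrE ?powR_ge0//; last by rewrite ltW// divr_gt0.
rewrite root_powK ?level_sqnorm_ge0//.
apply: (le_trans (HC l)); rewrite expr_div_n -exprM mulrCA ler_piMr//.
  by rewrite exprn_ge0// ltW// divr_gt0.
rewrite ler_pdivrMr ?exprn_gt0// mul1r.
apply: (le_trans (ler_norm C)); apply/ltW.
apply: (lt_le_trans (truncnS_gt _)).
by rewrite -natrX ler_nat (leq_trans Nl)// ltnW// ltn_expl.
Qed.

Fact uniformly_entire_closed : subalg_closed uniformly_entire.
Proof.
split.
- by apply/uniformly_entireP; apply: (@finsupp_subgeometric _ 0) => -[].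
- move=> a f g /uniformly_entireP Hf /uniformly_entireP Hg.
  by apply/uniformly_entireP/subgeometricD => //; exact: subgeometricZ.
- move=> f g /uniformly_entireP Hf /uniformly_entireP Hg.
  by apply/uniformly_entireP; exact: subgeometricM.
Qed.

HB.instance Definition _ := GRing.isSubalgClosed.Build R[i] S
  uniformly_entire (GRing.subalg_closed_semi uniformly_entire_closed).

End NCSeries.

Record entire_series (R : realType) (d : nat) := EntireSeries {
  series_of :> ncseries R d;
  _ : series_of \in @uniformly_entire R d }.

Section EntireSeries.
Variables (R : realType) (d : nat).
Local Notation O := (entire_series R d).

HB.instance Definition _ := [isSub for @series_of R d].
HB.instance Definition _ := [Choice of O by <:].
HB.instance Definition _ := [SubChoice_isSubAlgebra of O by <:].

Fact ncvar_entire (x : 'I_d) : @ncvar R d x \in @uniformly_entire R d.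
Proof.
apply/uniformly_entireP; apply: (@finsupp_subgeometric _ _ _ 1) => w w_gt1.
by rewrite /ncvar; case: eqP w_gt1 => // ->.
Qed.

Definition entire_var (x : 'I_d) : O := EntireSeries (ncvar_entire x).

End EntireSeries.

Arguments entire_var {R d} x.

Section NoncommutativeMatrices.

Definition mx_factors (B : pzRingType) (m n : nat) (X : 'M[B]_(m, n))
    (k : nat) : bool :=
  `[< exists (Y : 'M[B]_(m, k)) (Z : 'M[B]_(k, n)), X = Y *m Z >].

Fact mx_factors_exists (B : pzRingType) m n (X : 'M[B]_(m, n)) :
  exists k, mx_factors X k.
Proof. by exists n; apply/asboolP; exists X, 1%:M; rewrite mulmx1. Qed.

Definition inner_rank (B : pzRingType) m n (X : 'M[B]_(m, n)) : nat :=
  ex_minn (mx_factors_exists X).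

Definition full_mx (B : pzRingType) n (X : 'M[B]_n) : Prop :=
  inner_rank X = n.

(* invmx is only available over commutative rings. *)
Definition is_mxinv (B : pzRingType) n (X Y : 'M[B]_n) : Prop :=
  X *m Y = 1%:M /\ Y *m X = 1%:M.

Definition mx_invertible (B : pzRingType) n (X : 'M[B]_n) : Prop :=
  exists Y, is_mxinv X Y.

(* The inverse of X, and 0 if X is not invertible. *)
Definition mxinv (B : pzRingType) n (X : 'M[B]_n) : 'M[B]_n :=
  xget 0 [set Y | is_mxinv X Y].

Definition stably_finite (B : pzRingType) : Prop :=
  forall n (X Y : 'M[B]_n), X *m Y = 1%:M -> Y *m X = 1%:M.

End NoncommutativeMatrices.

Record universal_skew_field_of_fractions (B : nzRingType) (M : unitRingType)
    (iota : {rmorphism B -> M}) : Prop := UniversalSkewFieldOfFractions {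
  usff_skew_field : forall x : M, x != 0 -> x \is a GRing.unit;
  usff_injective : injective iota;
  usff_generated : forall S : {pred M}, divring_closed S ->
    (forall h, iota h \in S) -> forall x, x \in S;
  usff_full : forall n (X : 'M[B]_n), full_mx X ->
    mx_invertible (map_mx iota X) }.

(* x \otimes X, for the identification of the tensor product of B with the
   complex m x n matrices with the m x n matrices over B. *)
Definition tensmx (R : realType) (B : lalgType R[i]) m n (x : B)
    (X : 'M[R[i]]_(m, n)) : 'M[B]_(m, n) :=
  map_mx (fun t => t *: x) X.

Definition pencil (R : realType) (B : lalgType R[i]) n k
    (A : 'I_k.+1 -> 'M[R[i]]_n) (x : 'rV[B]_k) : 'M[B]_n :=
  tensmx 1 (A ord0) + \sum_(j < k) tensmx (x 0 j) (A (lift ord0 j)).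

Definition ctrmx (R : realType) m n (X : 'M[R[i]]_(m, n)) : 'M[R[i]]_(n, m) :=
  (map_mx Num.conj X)^T.

Record formal_data (R : realType) (d : nat) := FormalData {
  fd_n : nat;
  fd_k : nat;
  fd_A : 'I_fd_k.+1 -> 'M[R[i]]_fd_n;
  fd_b : 'cV[R[i]]_fd_n;
  fd_c : 'cV[R[i]]_fd_n;
  fd_h : 'rV[entire_series R d]_fd_k }.

Arguments fd_A {R d} f _.

Section Representations.
Variables (R : realType) (d : nat).
Local Notation O := (entire_series R d).

Definition is_formal_representation (M : unitRingType)
    (iota : {rmorphism O -> M}) (f : M) (r : formal_data R d) : Prop :=
  let AM := map_mx iota (pencil (fd_A r) (fd_h r)) in
  mx_invertible AM /\
  f = (map_mx iota (tensmx 1 (ctrmx (fd_b r))) *m mxinv AM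
         *m map_mx iota (tensmx 1 (fd_c r))) 0 0.

Variables (A : algType R[i]) (phi : {lrmorphism O -> A}).

Definition fd_domain (r : formal_data R d) : set 'rV[A]_d :=
  [set a | (forall i, phi (entire_var i) = a 0 i) /\
           mx_invertible (pencil (fd_A r) (map_mx phi (fd_h r)))].

Definition fd_eval (r : formal_data R d) : A :=
  (tensmx 1 (ctrmx (fd_b r))
     *m mxinv (pencil (fd_A r) (map_mx phi (fd_h r)))
     *m tensmx 1 (fd_c r)) 0 0.

Definition nc_domain (M : unitRingType) (iota : {rmorphism O -> M}) (f : M) :
    set 'rV[A]_d :=
  [set a | exists2 r, is_formal_representation iota f r & fd_domain r a].

End Representations.

(* Main.v *)
Require Import Defs.
From HB Require Import structures.
From mathcomp Require Import all_boot all_order all_algebra.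
From mathcomp Require Import complex.
From mathcomp Require Import all_classical all_reals all_analysis.

Import GRing.Theory.

Local Open Scope classical_set_scope.
Local Open Scope ring_scope.
Local Open Scope complex_scope.

(** The difference of the values of two representations is itself the value
    [u D^-1 v] of one realization, with [D] the block diagonal sum of the two
    pencils.  Up to sign this value is the Schur complement of [D] in the
    bordered matrix [Q = [D, v; u, 0]] with entries in the entire series, so
    the theorem says that its vanishing passes from the skew field [M] to the
    algebra [A].

    Since [D] becomes invertible over [M] with Schur complement zero, [Q] is
    singular over [M] ([singular_of_schur_eq0]); as full matrices become
    invertible over [M], [Q] is not full, that is, [Q = Y Z] with inner
    dimension equal to the size of [D] ([factor_of_not_full]).  A factorization
    over the entire series is an identity that every homomorphism preserves,
    hence it survives evaluation at [a].  There, the top block [Y1] of [Y] and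
    the left block [Z1] of [Z] are square with [Y1 Z1 = D] invertible, so by
    stable finiteness [Z1 D^-1] is a two-sided inverse of [Y1], and the value
    [u D^-1 v = y2 (Z1 D^-1 Y1) z2 = y2 z2] is the corner of [Q], which is zero
    ([schur_eq0_of_factor]). *)

(** * Inverses over noncommutative rings *)

Lemma mxinvP {B : pzRingType} {n} {X : 'M[B]_n} :
  mx_invertible X -> is_mxinv X (mxinv X).
Proof. by case=> Y XY; apply: (xgetPex 0 (P := is_mxinv X)); exists Y. Qed.

Lemma is_mxinv_map_diag {B C : pzRingType} {phi : {rmorphism B -> C}} {m n}
    {X : 'M[B]_m} {Y : 'M[B]_n} {X' : 'M[C]_m} {Y' : 'M[C]_n} :
  is_mxinv (map_mx phi X) X' -> is_mxinv (map_mx phi Y) Y' ->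
  is_mxinv (map_mx phi (block_mx X 0 0 Y)) (block_mx X' 0 0 Y').
Proof.
move=> [XX' X'X] [YY' Y'Y]; rewrite map_block_mx !map_mx0.
by split; rewrite mulmx_block !mulmx0 !mul0mx !addr0 !add0r ?XX' ?X'X ?YY' ?Y'Y
  -scalar_mx_block.
Qed.

(** * Schur complements, singularity and factorizations *)

(** When the Schur complement of [D] vanishes, the column [[- D^-1 v; 1]] is a
    nonzero element of the kernel. *)
Lemma singular_of_schur_eq0 {B : nzRingType} {m}
    {D D' : 'M[B]_m} {u : 'rV[B]_m} {v : 'cV[B]_m} :
  is_mxinv D D' -> u *m D' *m v = 0 -> ~ mx_invertible (block_mx D v u 0).
Proof.
move=> [DD' _] uv0 [X [_ XQ]].
pose w : 'cV[B]_(m + 1) := col_mx (- (D' *m v)) 1%:M.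
have Qw0 : block_mx D v u 0 *m w = 0.
  rewrite mul_block_col mul0mx addr0 !mulmxN !mulmxA DD' mul1mx uv0.
  by rewrite mulmx1 addNr oppr0 col_mx0.
have w0 : w = 0 by rewrite -[w]mul1mx -XQ -mulmxA Qw0 mulmx0.
move/(congr1 (fun x : 'cV[B]_(m + 1) => dsubmx x 0 0)): w0.
by rewrite col_mxKd !mxE => /eqP; rewrite oner_eq0.
Qed.

(** The inner rank only provides some inner dimension below [m + 1]; padding
    with zeros gives exactly [m], so that the blocks facing [D] are square and
    stable finiteness applies to them. *)
Lemma factor_of_not_full {B : pzRingType} {m} {X : 'M[B]_(m + 1)} :
  ~ full_mx X ->
  exists (Y : 'M[B]_(m + 1, m)) (Z : 'M[B]_(m, m + 1)), X = Y *m Z.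
Proof.
rewrite /full_mx /inner_rank; case: ex_minnP => k /asboolP[Y [Z XYZ]] kmin kN.
have k_le : (k <= m + 1)%N.
  by apply: kmin; apply/asboolP; exists X, 1%:M; rewrite mulmx1.
have km : (k <= m)%N.
  by rewrite -ltnS -[m.+1]addn1 ltn_neqAle k_le andbT; apply/eqP.
exists (Y *m pid_mx k), (pid_mx k *m Z).
by rewrite mulmxA -[Y *m _ *m _]mulmxA pid_mx_id // pid_mx_1 mulmx1.
Qed.

(** The factorization passes through a space of the same size as the invertible
    block [D], so it leaves no room for a nonzero Schur complement, provided
    that the one-sided inverse of the top block of [Y] read off from [D] is
    two-sided. *)
Lemma schur_eq0_of_factor {B : pzRingType} {m p q}
    {D D' : 'M[B]_m} {u : 'M[B]_(p, m)} {v : 'M[B]_(m, q)}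
    {Y : 'M[B]_(m + p, m)} {Z : 'M[B]_(m, m + q)} :
  stably_finite B -> is_mxinv D D' -> block_mx D v u 0 = Y *m Z ->
  u *m D' *m v = 0.
Proof.
move=> sfB [DD' _].
rewrite -[Y]vsubmxK -[Z]hsubmxK mul_col_row.
move: (usubmx Y) (dsubmx Y) (lsubmx Z) (rsubmx Z) => Y1 y2 Z1 z2.
case/eq_block_mx=> DE vE uE y2z2.
have ZY : Z1 *m D' *m Y1 = 1%:M by apply: sfB; rewrite mulmxA -DE.
by rewrite uE vE -!mulmxA (mulmxA D') (mulmxA Z1) (mulmxA Z1) ZY mul1mx.
Qed.

(** There need be no homomorphism between [M] and [C], so an identity that
    involves the inverse of [D] over [M] cannot be mapped to [C].  The
    factorization of the bordered matrix encodes it without inverses, over [B],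
    from where [phi] carries it to [C]. *)
Lemma schur_eq0_transfer {B M : nzRingType} {C : pzRingType}
    {iota : {rmorphism B -> M}} {phi : {rmorphism B -> C}} {m}
    {D : 'M[B]_m} {u : 'rV[B]_m} {v : 'cV[B]_m}
    {DM : 'M[M]_m} {DC : 'M[C]_m} :
  (forall n (X : 'M[B]_n), full_mx X -> mx_invertible (map_mx iota X)) ->
  stably_finite C ->
  is_mxinv (map_mx iota D) DM -> is_mxinv (map_mx phi D) DC ->
  map_mx iota u *m DM *m map_mx iota v = 0 ->
  map_mx phi u *m DC *m map_mx phi v = 0.
Proof.
move=> full_inv sfC DM_inv DC_inv uv0.
have /factor_of_not_full[Y [Z QYZ]] : ~ full_mx (block_mx D v u 0).
  move/full_inv; rewrite map_block_mx map_mx0.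
  exact: singular_of_schur_eq0 DM_inv uv0.
apply: (schur_eq0_of_factor (Y := map_mx phi Y) (Z := map_mx phi Z) sfC DC_inv).
by rewrite -map_mxM -QYZ map_block_mx map_mx0.
Qed.

(** * Values of formal representations *)

Lemma map_tensmx {R : realType} {B C : algType R[i]}
    (phi : {lrmorphism B -> C}) {m n} (x : B) (X : 'M[R[i]]_(m, n)) :
  map_mx phi (tensmx x X) = tensmx (phi x) X.
Proof. by apply/matrixP => i j; rewrite !mxE linearZ. Qed.

Lemma map_pencil {R : realType} {B C : algType R[i]}
    (phi : {lrmorphism B -> C}) {n k} (A : 'I_k.+1 -> 'M[R[i]]_n)
    (x : 'rV[B]_k) :
  map_mx phi (pencil A x) = pencil A (map_mx phi x).
Proof.
rewrite /pencil map_mxD map_tensmx rmorph1 map_mx_sum; congr (_ + _).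
by apply: eq_bigr => j _; rewrite map_tensmx mxE.
Qed.

Lemma mul_row_diag_col {B : pzRingType} {m n} (u : 'rV[B]_m) (u' : 'rV[B]_n)
    (X : 'M[B]_m) (X' : 'M[B]_n) (v : 'cV[B]_m) (v' : 'cV[B]_n) :
  row_mx u (- u') *m block_mx X 0 0 X' *m col_mx v v' =
  u *m X *m v - u' *m X' *m v'.
Proof.
by rewrite mul_row_block !mulmx0 addr0 add0r mul_row_col !mulNmx.
Qed.

Lemma fd_eval_unique {R : realType} {d : nat} {M : unitRingType}
    {iota : {rmorphism entire_series R d -> M}} {A : algType R[i]}
    {phi : {lrmorphism entire_series R d -> A}} {f : M} {a : 'rV[A]_d}
    {r r' : formal_data R d} :
  universal_skew_field_of_fractions iota -> stably_finite A ->
  is_formal_representation iota f r -> is_formal_representation iota f r' ->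
  fd_domain phi r a -> fd_domain phi r' a -> fd_eval phi r = fd_eval phi r'.
Proof.
case=> _ _ _ full_inv sfA [/mxinvP MP fE] [/mxinvP MP' fE'].
move=> [_ /mxinvP AP] [_ /mxinvP AP'].
rewrite -!map_pencil in AP AP'.
have MD := is_mxinv_map_diag MP MP'; have AD := is_mxinv_map_diag AP AP'.
have := schur_eq0_transfer
  (u := row_mx (tensmx 1 (ctrmx (fd_b r))) (- tensmx 1 (ctrmx (fd_b r'))))
  (v := col_mx (tensmx 1 (fd_c r)) (tensmx 1 (fd_c r')))
  full_inv sfA MD AD.
rewrite !map_row_mx !map_col_mx !map_mxN !mul_row_diag_col.
rewrite !(map_tensmx phi) rmorph1 !map_pencil => transfer.
apply/eqP; rewrite -subr_eq0; apply/eqP.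
(* Both hypothesis and goal are about the only entry of a 1 x 1 matrix. *)
have /matrixP/(_ 0 0) : tensmx 1 (ctrmx (fd_b r))
     *m mxinv (pencil (fd_A r) (map_mx phi (fd_h r))) *m tensmx 1 (fd_c r)
   - tensmx 1 (ctrmx (fd_b r'))
     *m mxinv (pencil (fd_A r') (map_mx phi (fd_h r'))) *m tensmx 1 (fd_c r')
   = 0 :> 'M[A]_1.
  apply: transfer; apply/matrixP => i j; rewrite !ord1.
  by rewrite [LHS]mxE [X in _ + X]mxE -fE -fE' subrr mxE.
by rewrite [LHS]mxE [X in _ + X]mxE [RHS]mxE.
Qed.

Theorem theorem6p1 (R : realType) (d : nat)
    (M : unitRingType) (iota : {rmorphism entire_series R d -> M})
    (hM : universal_skew_field_of_fractions iota)
    (A : algType R[i]) (hA : stably_finite A)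
    (f : M) (a : 'rV[A]_d) (phi : {lrmorphism entire_series R d -> A}) :
  (forall r r' : formal_data R d,
     is_formal_representation iota f r ->
     is_formal_representation iota f r' ->
     (fd_domain phi r `&` fd_domain phi r') a ->
     fd_eval phi r = fd_eval phi r') /\
  (nc_domain phi iota f a ->
   exists! v : A, forall r : formal_data R d,
     is_formal_representation iota f r -> fd_domain phi r a ->
     fd_eval phi r = v).
Proof.
split=> [r r' rf r'f [ra r'a]|[r rf ra]].
  exact: fd_eval_unique hM hA rf r'f ra r'a.
exists (fd_eval phi r); split=> [r' r'f r'a|v ->//].
exact: fd_eval_unique hM hA r'f rf r'a ra.
Qed.
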